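(* Let $\vec r(u,v)=(x(u,v),y(u,v),z(u,v))$, $(u,v)\in D$, be a surface of class $C^2$ in $\mathbb{R}^3$ not passing through $O=(0,0,0)$, and let $u=u(t)$, $v=v(t)$, $t_0<t<t_1$, be a (differentiable) curve lying on the surface. Let $P=P(t)=\vec r(u(t),v(t))$ be the moving point on this curve with parameter $t$, and put $$\vec r_A=(x,y,0),\qquad \vec r_B=(x,0,z),\qquad \vec r_C=(0,y,z),$$ with $x,y,z$ regarded as functions of $(u,v)$; assume these projected vectors are nonzero along the curve. Then, with all functions of $(u,v)$ evaluated at $(u(t),v(t))$ and $u'=u'(t)$, $v'=v'(t)$: (i) For $\mathcal{D}=|\overrightarrow{OP}|$, we have $$\frac{d\mathcal{D}}{dt}=\frac{\vec r\cdot(\vec r_uu'+\vec r_vv')}{\sqrt{\vec r^2}}.$$ (ii) The rotational speed of $\overrightarrow{OP}_A=(x(u(t),v(t)),y(u(t),v(t)),0)$ with respect to $t$ is $$\left|\frac{-\left[\vec r_A\cdot\left(\frac{\partial\vec r_A}{\partial u}u'+\frac{\partial\vec r_A}{\partial v}v'\right)\right]\vec r_A+\left(\frac{\partial\vec r_A}{\partial u}u'+\frac{\partial\vec r_A}{\partial v}v'\right)\vec r_A^2}{(\vec r_A^2)^{3/2}}\right|.$$ (iii) The rotational speed of $\overrightarrow{OP}_B=(x(u(t),v(t)),0,z(u(t),v(t)))$ with respect to $t$ is $$\left|\frac{-\left[\vec r_B\cdot\left(\frac{\partial\vec r_B}{\partial u}u'+\frac{\partial\vec r_B}{\partial v}v'\right)\right]\vec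 r_B+\left(\frac{\partial\vec r_B}{\partial u}u'+\frac{\partial\vec r_B}{\partial v}v'\right)\vec r_B^2}{(\vec r_B^2)^{3/2}}\right|.$$ (iv) The rotational speed of $\overrightarrow{OP}_C=(0,y(u(t),v(t)),z(u(t),v(t)))$ with respect to $t$ is $$\left|\frac{-\left[\vec r_C\cdot\left(\frac{\partial\vec r_C}{\partial u}u'+\frac{\partial\vec r_C}{\partial v}v'\right)\right]\vec r_C+\left(\frac{\partial\vec r_C}{\partial u}u'+\frac{\partial\vec r_C}{\partial v}v'\right)\vec r_C^2}{(\vec r_C^2)^{3/2}}\right|.$$
   Context: $\vec w^2=\vec w\cdot\vec w$ for a vector $\vec w$; $\vec r_u,\vec r_v$ are partial derivatives. For a nowhere-zero differentiable vector function $\vec w(t)$, with $\vec e_{\vec w}=\vec w/|\vec w|$, the rotational speed of $\vec w$ with respect to $t$ is $\left|\frac{d\vec e_{\vec w}}{dt}\right|$. *)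

(* Defs.v *)
From Stdlib Require Import Reals.
From Coquelicot Require Import Coquelicot.
Open Scope R_scope.

Definition vec3 : Type := (R * R * R)%type.

Definition vec3_NM : NormedModule R_AbsRing :=
  prod_NormedModule R_AbsRing
    (prod_NormedModule R_AbsRing R_NormedModule R_NormedModule) R_NormedModule.

Definition px (w : vec3) : R := fst (fst w).
Definition py (w : vec3) : R := snd (fst w).
Definition pz (w : vec3) : R := snd w.

Definition vzero : vec3 := (0, 0, 0).
Definition vadd (a b : vec3) : vec3 := (px a + px b, py a + py b, pz a + pz b).
Definition vscal (k : R) (a : vec3) : vec3 := (k * px a, k * py a, k * pz a).
Definition dot (a b : vec3) : R := px a * px b + py a * py b + pz a * pz b.
Definition vlen (a : vec3) : R := sqrt (dot a a).

(* [Derive] is total: this is the derivative only where the components are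
   differentiable. *)
Definition VDerive (w : R -> vec3) (t : R) : vec3 :=
  (Derive (fun s => px (w s)) t,
   Derive (fun s => py (w s)) t,
   Derive (fun s => pz (w s)) t).

Definition partial_u (q : R -> R -> vec3) (a b : R) : vec3 :=
  VDerive (fun s => q s b) a.
Definition partial_v (q : R -> R -> vec3) (a b : R) : vec3 :=
  VDerive (fun s => q a s) b.

(* [ex_diff_n f 2 a b] only constrains the partial derivatives of order at most
   2 at the point itself; required at all points of an open set [D], it says
   that they exist and are continuous on [D]. *)
Definition surface_C2 (D : R * R -> Prop) (q : R -> R -> vec3) : Prop :=
  forall a b : R, D (a, b) ->
    ex_diff_n (fun u v => px (q u v)) 2 a b /\
    ex_diff_n (fun u v => py (q u v)) 2 a b /\
    ex_diff_n (fun u v => pz (q u v)) 2 a b.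

Definition unit_vec (w : vec3) : vec3 := vscal (/ vlen w) w.

(* The rotational speed of [w] at [t] exists and equals [s]. It is meant for
   [w] nonzero near [t], since [unit_vec] is a dummy value at 0. *)
Definition is_rotational_speed (w : R -> vec3) (t s : R) : Prop :=
  exists d : vec3,
    is_derive (V := vec3_NM) (fun tau => unit_vec (w tau)) t d /\ vlen d = s.

(* Main.v *)
(** A C^1 function on an open set is totally differentiable, so the chain rule
    gives the velocity d = r_u u' + r_v v' of each (projected) point w. Then
    |w|' = w.d / |w|, and the quotient rule applied to w / |w| yields
    (-(w.d) w + w^2 d) / |w|^3, whose length is the rotational speed. *)

Require Import Defs.
From Stdlib Require Import Reals Lra.
From Coquelicot Require Import Coquelicot.
Open Scope R_scope.

(** The pairing map, read on the product space, is the identity, so it is its own differential; the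
    chain rule through two arguments then gives the claim. *)
Lemma is_derive_pair (U V : NormedModule R_AbsRing) (f : R -> U) (g : R -> V)
  (t : R) (df : U) (dg : V) :
  is_derive f t df -> is_derive g t dg ->
  is_derive (V := prod_NormedModule R_AbsRing U V) (fun s => (f s, g s)) t (df, dg).
Proof.
intros Hf Hg.
unfold is_derive.
apply filterdiff_ext_lin with (fun s : R => (scal s df, scal s dg)).
- apply (filterdiff_comp'_2 (W := prod_NormedModule R_AbsRing U V) f g
    (fun a b => (a, b)) t _ _ (fun a b => (a, b)) Hf Hg).
  apply filterdiff_ext with (fun p : prod_NormedModule R_AbsRing U V => p).
  { now intros []. }
  apply filterdiff_ext_lin with (fun p : prod_NormedModule R_AbsRing U V => p).
  + apply filterdiff_id.
  + now intros [].
- reflexivity.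
Qed.

(** Working by coordinates leaves only real calculus; the passage to the normed module [vec3_NM] is
    made once, at the end. *)
Definition is_vderive (w : R -> vec3) (t : R) (d : vec3) : Prop :=
  is_derive (fun s => px (w s)) t (px d) /\
  is_derive (fun s => py (w s)) t (py d) /\
  is_derive (fun s => pz (w s)) t (pz d).

Lemma is_vderive_is_derive (w : R -> vec3) (t : R) (d : vec3) :
  is_vderive w t d -> is_derive (V := vec3_NM) w t d.
Proof.
intros [Hx [Hy Hz]].
destruct d as [[dx dy] dz].
apply is_derive_ext with (fun s => (px (w s), py (w s), pz (w s))).
{ intros s; now destruct (w s) as [[a b] c]. }
exact (is_derive_pair _ _ _ _ _ _ _ (is_derive_pair _ _ _ _ _ _ _ Hx Hy) Hz).
Qed.

Lemma dot_self_pos (a : vec3) : a <> vzero -> 0 < dot a a.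
Proof.
destruct a as [[a b] c]; unfold dot, vzero; cbn; intros H.
destruct (Req_dec a 0) as [->|]; [|nra].
destruct (Req_dec b 0) as [->|]; [|nra].
destruct (Req_dec c 0) as [->|]; [|nra].
now elim H.
Qed.

Lemma is_derive_vlen (w : R -> vec3) (t : R) (d : vec3) :
  is_vderive w t d -> w t <> vzero ->
  is_derive (fun s => vlen (w s)) t (dot (w t) d / sqrt (dot (w t) (w t))).
Proof.
intros [Hx [Hy Hz]] Hw.
apply dot_self_pos in Hw.
assert (Hs := sqrt_lt_R0 _ Hw).
assert (Hd : is_derive (fun s => dot (w s) (w s)) t (2 * dot (w t) d)).
{ unfold dot.
  assert (Hsq : forall (c : R -> R) (dc : R), is_derive c t dc ->
    is_derive (fun s => c s * c s) t (2 * (c t * dc))).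
  { intros c dc Hc; auto_derive.
    - repeat split; eexists; eassumption.
    - change (fun x => c x) with c; rewrite (is_derive_unique _ _ _ Hc); ring. }
  replace (2 * _) with (2 * (px (w t) * px d) + 2 * (py (w t) * py d)
    + 2 * (pz (w t) * pz d)) by ring.
  now apply @is_derive_plus; [apply @is_derive_plus|];
    [apply (Hsq (fun s => px (w s))) | apply (Hsq (fun s => py (w s)))
    | apply (Hsq (fun s => pz (w s)))]. }
unfold vlen.
(* The factor 2 is restored to match the shape [df / (2 * sqrt _)] of the derivative of a square
   root. *)
replace (dot (w t) d / sqrt (dot (w t) (w t)))
  with (2 * dot (w t) d / (2 * sqrt (dot (w t) (w t)))) by (field; lra).
now apply (is_derive_sqrt (fun s => dot (w s) (w s))).
Qed.

(** This removes [Rpower], which is defined through the logarithm, so that [field] can deal with the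
    exponent. *)
Lemma Rpower_3_2 (a : R) : 0 < a -> Rpower a (3 / 2) = a * sqrt a.
Proof.
intros Ha.
replace (3 / 2) with (1 + / 2) by field.
now rewrite Rpower_plus, Rpower_1, Rpower_sqrt.
Qed.

Lemma is_vderive_unit_vec (w : R -> vec3) (t : R) (d : vec3) :
  is_vderive w t d -> w t <> vzero ->
  is_vderive (fun s => unit_vec (w s)) t
    (vscal (/ Rpower (dot (w t) (w t)) (3 / 2))
       (vadd (vscal (- dot (w t) d) (w t)) (vscal (dot (w t) (w t)) d))).
Proof.
intros Hd Hw.
assert (Hl := is_derive_vlen w t d Hd Hw).
apply dot_self_pos in Hw.
rewrite Rpower_3_2 by assumption.
assert (Hs := sqrt_lt_R0 _ Hw).
assert (Hq := sqrt_sqrt _ (Rlt_le _ _ Hw)).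
(* All three coordinates obey one formula with the same scalars [dot (w t) d] and [dot (w t) (w t)],
   so it is proved for an arbitrary coordinate [c]. *)
assert (component : forall (c : R -> R) (dc : R), is_derive c t dc ->
  is_derive (fun s => / vlen (w s) * c s) t
    (/ (dot (w t) (w t) * sqrt (dot (w t) (w t))) *
       (- dot (w t) d * c t + dot (w t) (w t) * dc))).
{ intros c dc Hc.
  assert (Hlen : vlen (w t) <> 0) by (apply Rgt_not_eq; exact Hs).
  assert (H := is_derive_mult _ _ _ _ _
    (is_derive_inv (fun s => vlen (w s)) _ _ Hl Hlen) Hc Rmult_comm).
  cbn -[vlen] in H; unfold plus, mult in H; cbn -[vlen] in H.
  replace (/ (_ * _) * _) with
    (- (dot (w t) d / sqrt (dot (w t) (w t))) / vlen (w t) ^ 2 * c t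
       + / vlen (w t) * dc); [exact H|].
  change (vlen (w t)) with (sqrt (dot (w t) (w t))).
  set (q := sqrt (dot (w t) (w t))) in *.
  (* With the squared length written as [q * q], both sides are rational in [q], and the identity is
     purely algebraic. *)
  rewrite <- Hq.
  field; lra. }
destruct Hd as [Hx [Hy Hz]].
split; [|split].
- exact (component _ _ Hx).
- exact (component _ _ Hy).
- exact (component _ _ Hz).
Qed.

Lemma is_rotational_speed_intro (w : R -> vec3) (t : R) (d : vec3) :
  is_vderive w t d -> w t <> vzero ->
  is_rotational_speed w t
    (vlen (vscal (/ Rpower (dot (w t) (w t)) (3 / 2))
       (vadd (vscal (- dot (w t) d) (w t)) (vscal (dot (w t) (w t)) d)))).
Proof.
intros Hd Hw.
eexists; split; [|reflexivity].
now apply is_vderive_is_derive, is_vderive_unit_vec.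
Qed.

(** Serves the zero coordinate of the projected surfaces. The induction runs over all [c] at once
    because the partial derivatives of a constant are the constant 0. *)
Lemma ex_diff_n_const (c : R) (n : nat) (a b : R) : ex_diff_n (fun _ _ => c) n a b.
Proof.
revert c a b; induction n as [|n IH]; intros c a b.
- split; [apply continuity_2d_pt_const | exact I].
- split; [apply continuity_2d_pt_const |].
  split; [apply ex_derive_const |].
  split; [apply ex_derive_const |].
  split; apply ex_diff_n_ext_loc with (fun _ _ => 0); try apply IH;
    apply locally_2d_forall; intros; symmetry; apply Derive_const.
Qed.

(** Total differentiability comes from three facts: the u-partial exists on a neighbourhood (as [D]
    is open), it is continuous at the point, and the v-partial exists at the point. *)
Lemma is_derive_comp_C2 (D : R * R -> Prop) (f : R -> R -> R) (u v : R -> R) (t : R) :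
  open D -> (forall a b, D (a, b) -> ex_diff_n f 2 a b) ->
  D (u t, v t) -> ex_derive u t -> ex_derive v t ->
  is_derive (fun s => f (u s) (v s)) t
    (Derive u t * Derive (fun s => f s (v t)) (u t) +
     Derive v t * Derive (fun s => f (u t) s) (v t)).
Proof.
intros HD Hf Ht Hu Hv.
apply is_derive_Reals.
rewrite (Rmult_comm (Derive u t)), (Rmult_comm (Derive v t)).
apply derivable_pt_lim_comp_2d;
  try (apply is_derive_Reals, Derive_correct; assumption).
apply filterdiff_differentiable_pt_lim.
apply (is_derive_filterdiff f (u t) (v t) (fun a b => Derive (fun s => f s b) a)).
- generalize (HD _ Ht).
  apply filter_imp.
  intros [a b] Hab.
  apply Derive_correct, (proj2 (Hf a b Hab)).
- apply Derive_correct, (proj2 (Hf _ _ Ht)).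
- apply (continuity_2d_pt_filterlim (fun a b => Derive (fun s => f s b) a)).
  apply (proj2 (Hf _ _ Ht)).
Qed.

Lemma is_vderive_comp_C2 (D : R * R -> Prop) (q : R -> R -> vec3) (u v : R -> R) (t : R) :
  open D -> surface_C2 D q ->
  D (u t, v t) -> ex_derive u t -> ex_derive v t ->
  is_vderive (fun s => q (u s) (v s)) t
    (vadd (vscal (Derive u t) (partial_u q (u t) (v t)))
          (vscal (Derive v t) (partial_v q (u t) (v t)))).
Proof.
intros HD Hq Ht Hu Hv.
split; [|split].
- apply (is_derive_comp_C2 D (fun a b => px (q a b))); auto; intros; now apply Hq.
- apply (is_derive_comp_C2 D (fun a b => py (q a b))); auto; intros; now apply Hq.
- apply (is_derive_comp_C2 D (fun a b => pz (q a b))); auto; intros; now apply Hq.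
Qed.

Theorem proposition4p1 :
  forall (D : R * R -> Prop) (x y z : R -> R -> R) (u v : R -> R) (t0 t1 : R),
  let r   := fun a b : R => (x a b, y a b, z a b) : vec3 in
  let r_A := fun a b : R => (x a b, y a b, 0) : vec3 in
  let r_B := fun a b : R => (x a b, 0, z a b) : vec3 in
  let r_C := fun a b : R => (0, y a b, z a b) : vec3 in
  (* derivative of q in the direction (u', v') *)
  let dir := fun (q : R -> R -> vec3) (a b u' v' : R) =>
    vadd (vscal u' (partial_u q a b)) (vscal v' (partial_v q a b)) in
  let speed := fun (q : R -> R -> vec3) (a b u' v' : R) =>
    vlen (vscal (/ Rpower (dot (q a b) (q a b)) (3 / 2))
            (vadd (vscal (- dot (q a b) (dir q a b u' v')) (q a b))
                  (vscal (dot (q a b) (q a b)) (dir q a b u' v')))) in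
  open D ->
  surface_C2 D r ->
  (forall a b : R, D (a, b) -> r a b <> vzero) ->
  (forall t : R, t0 < t < t1 -> D (u t, v t)) ->
  (forall t : R, t0 < t < t1 -> ex_derive u t /\ ex_derive v t) ->
  (forall t : R, t0 < t < t1 ->
     r_A (u t) (v t) <> vzero /\
     r_B (u t) (v t) <> vzero /\
     r_C (u t) (v t) <> vzero) ->
  forall t : R, t0 < t < t1 ->
  let u' := Derive u t in
  let v' := Derive v t in
  is_derive (fun s => vlen (r (u s) (v s))) t
    (dot (r (u t) (v t)) (dir r (u t) (v t) u' v')
       / sqrt (dot (r (u t) (v t)) (r (u t) (v t)))) /\
  is_rotational_speed (fun s => r_A (u s) (v s)) t (speed r_A (u t) (v t) u' v') /\
  is_rotational_speed (fun s => r_B (u s) (v s)) t (speed r_B (u t) (v t) u' v') /\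
  is_rotational_speed (fun s => r_C (u s) (v s)) t (speed r_C (u t) (v t) u' v').
Proof.
intros D x y z u v t0 t1 r r_A r_B r_C dir speed HD Hr Hr0 Hcurve Huv Hproj t Ht u' v'.
destruct (Huv t Ht) as [Hu Hv].
destruct (Hproj t Ht) as [HA [HB HC]].
assert (HDt := Hcurve t Ht).
(* Each projection replaces one coordinate of [r] by 0 and so stays of class C^2; the chain rule
   then applies to it exactly as to [r]. *)
assert (C2_A : surface_C2 D r_A).
{ intros a b Hab; destruct (Hr a b Hab) as [Hx [Hy Hz]].
  split; [exact Hx | split; [exact Hy | apply (ex_diff_n_const 0 2)]]. }
assert (C2_B : surface_C2 D r_B).
{ intros a b Hab; destruct (Hr a b Hab) as [Hx [Hy Hz]].
  split; [exact Hx | split; [apply (ex_diff_n_const 0 2) | exact Hz]]. }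
assert (C2_C : surface_C2 D r_C).
{ intros a b Hab; destruct (Hr a b Hab) as [Hx [Hy Hz]].
  split; [apply (ex_diff_n_const 0 2) | split; [exact Hy | exact Hz]]. }
split; [|split; [|split]].
(* The length is differentiated away from the origin: for [r] the surface avoids O, while each
   projection relies on its own assumption along the curve. *)
- apply (is_derive_vlen (fun s => r (u s) (v s))); [|now apply Hr0].
  now apply (is_vderive_comp_C2 D).
- apply (is_rotational_speed_intro (fun s => r_A (u s) (v s))); [|assumption].
  now apply (is_vderive_comp_C2 D).
- apply (is_rotational_speed_intro (fun s => r_B (u s) (v s))); [|assumption].
  now apply (is_vderive_comp_C2 D).
- apply (is_rotational_speed_intro (fun s => r_C (u s) (v s))); [|assumption].
  now apply (is_vderive_comp_C2 D).
Qed.
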